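(* Assume that $\mathbb{E}\log\rho\in[-\infty,0)$ and $\mathbb{E}\xi<\infty$. Let $v:=\mathbb{E}\xi/\mathbb{E}T_{S_1}$ (with $v=0$, $1/v=\infty$ if $\mathbb{E}T_{S_1}=\infty$). Then $$v=\frac{(1-\mathbb{E}\rho)\,\mathbb{E}\xi}{(1-\mathbb{E}\rho)\,\mathbb{E}[\xi^2]+2\,\mathbb{E}\xi\,\mathbb{E}[\rho\xi]},\qquad \frac1v=\frac{1}{\mathbb{E}\xi}\left(\mathbb{E}[\xi^2]+\frac{2\,\mathbb{E}\xi\,\mathbb{E}[\rho\xi]}{1-\mathbb{E}\rho}\right)$$ provided that $\mathbb{E}\rho<1$, $\mathbb{E}[\rho\xi]<\infty$ and $\mathbb{E}[\xi^2]<\infty$; and $v=0$ ($1/v=\infty$) otherwise.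
   Context: Write $\mathbb{N}=\{1,2,\ldots\}$. Let $(\xi,\lambda)$ be a random vector with $\xi\in\mathbb{N}$ and $\lambda\in(0,1)$ a.s. ($\xi$ and $\lambda$ may be dependent), and put $\rho:=(1-\lambda)/\lambda$. Let $((\xi_k,\lambda_k))_{k\in\mathbb{Z}}$ be independent copies of $(\xi,\lambda)$. Put $S_0=0$, $S_n=\sum_{k=1}^n\xi_k$ for $n>0$ and $S_n=-\sum_{k=n+1}^{0}\xi_k$ for $n<0$. The sparse random environment $\omega=(\omega_n)_{n\in\mathbb{Z}}$ is defined by $\omega_n=\lambda_{k+1}$ if $n=S_k$ for some $k\in\mathbb{Z}$, and $\omega_n=1/2$ otherwise. Given $\omega$, under the quenched law $\mathbb{P}_\omega$, $(X_n)_{n\ge0}$ is a Markov chain on $\mathbb{Z}$ with $X_0=0$ which jumps from $i$ to $i+1$ with probability $\omega_i$ and from $i$ to $i-1$ with probability $1-\omega_i$. $\mathbb{P}$ denotes the annealed law (the average of $\mathbb{P}_\omega$ over $\omega$) and $\mathbb{E}$ the corresponding expectation. $T_n:=\inf\{k\ge0:X_k=n\}$, $n\in\mathbb{Z}$, are the first passage times. (It is known that, under the assumptions of the claim, $X_n\to+\infty$, $X_n/n\to v$ and $T_n/n\to 1/v$ $\mathbb{P}$-a.s., i.e. $v$ is the asymptotic speed.) *)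

(* Defs.v *)
From HB Require Import structures.
From mathcomp Require Import all_boot all_order all_algebra.
From mathcomp Require Import all_classical all_reals all_analysis.
From mathcomp Require Import measurable_realfun.
Set Implicit Arguments.
Unset Strict Implicit.
Unset Printing Implicit Defensive.
Import Order.TTheory GRing.Theory Num.Theory.
Import numFieldNormedType.Exports.
Local Open Scope classical_set_scope.
Local Open Scope ring_scope.

Section Environment.
Context {R : realType}.

(* A realization of [(xi, lambda)] is a pair [z : nat * R]. *)
Definition xi (z : nat * R) : R := z.1%:R.
Definition lambda (z : nat * R) : R := z.2.
Definition rho (z : nat * R) : R := (1 - lambda z) / lambda z.

(* [Negz m] is [- (m + 1)], so in the second case the sum ranges over the
   indices [k = - j] from [n + 1 = - m] up to [0]. *)
Definition partial_sum (x : int -> nat) (n : int) : int :=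
  match n with
  | Posz m => \sum_(1 <= k < m.+1) (x k%:Z)%:Z
  | Negz m => - \sum_(0 <= j < m.+1) (x (- j%:Z))%:Z
  end.

Definition marked_sites (z : int -> nat * R) : int -> int :=
  partial_sum (fun k => (z k).1).

(* If all [xi]'s are positive, the index [k] below is unique. *)
Definition sparse_env (z : int -> nat * R) (n : int) : R :=
  match pselect (exists k, n = marked_sites z k) with
  | left nS => lambda (z (projT1 (cid nS) + 1))
  | right _ => 2^-1
  end.

Definition step_prob (omega : int -> R) (i j : int) : R :=
  if j == i + 1 then omega i else if j == i - 1 then 1 - omega i else 0.

End Environment.

Section Independence.
Context {d d' : measure_display} {T : measurableType d} {U : measurableType d'}
  {R : realType}.

Definition mutually_independent (P : probability T R) (Z : int -> T -> U) :=
  forall (s : seq int) (A : int -> set U), uniq s ->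
    (forall k, measurable (A k)) ->
    P (\bigcap_(k in [set` s]) (Z k @^-1` A k)) =
    (\prod_(k <- s) P (Z k @^-1` A k))%E.

End Independence.

Section Walk.
Context {d : measure_display} {W : measurableType d} {R : realType}.

Definition is_walk_in_env (omega : int -> R) (X : nat -> W -> int)
    (Q : set W -> \bar R) :=
  Q [set x | X 0%N x = 0] = 1%E /\
  forall (n : nat) (p : nat -> int),
    Q [set x | forall m, (m <= n.+1)%N -> X m x = p m] =
    (Q [set x | forall m, (m <= n)%N -> X m x = p m] *
     (step_prob omega (p n) (p n.+1))%:E)%E.

(* The infimum of the empty set is [+oo]. *)
Definition passage_time (X : nat -> W -> int) (n : int) (x : W) : \bar R :=
  ereal_inf [set k%:R%:E | k in [set k : nat | X k x = n]].

End Walk.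

Section Annealed.
Context {d d' : measure_display} {E : measurableType d} {W : measurableType d'}
  {R : realType}.
Variables (P : probability E R) (Pq : R.-pker E ~> W).
Local Open Scope ereal_scope.

Definition annealed (A : set (E * W)) : \bar R :=
  \int[P]_e Pq e (xsection A e).

Let measurable_section (A : set (E * W)) : measurable A ->
  measurable_fun [set: E] (fun e => Pq e (xsection A e)).
Proof.
move=> mA; rewrite -kfcompkindic//.
apply: measurable_kfcomp => //; first exact/measurable_EFinP/measurable_indic.
by move=> t; rewrite lee_fin.
Qed.

Let annealed0 : annealed set0 = 0.
Proof. by apply: integral0_eq => e _; rewrite xsection0 measure0. Qed.

Let annealed_ge0 A : 0 <= annealed A.
Proof. by apply: integral_ge0 => e _; exact: measure_ge0. Qed.

Let annealed_additive : semi_sigma_additive annealed.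
Proof.
move=> A mA tA mUA.
rewrite [X in _ --> X](_ : _ = \sum_(0 <= n <oo) annealed (A n)).
  by apply: is_cvg_nneseries => n _ _; exact: annealed_ge0.
rewrite /annealed -integral_nneseries//; last first.
  by move=> n; exact: measurable_section.
apply: eq_integral => e _; rewrite xsection_bigcup measure_bigcup//.
- by apply: eq_eseriesl => n; rewrite in_setT.
- by move=> n _; exact: measurable_xsection.
- exact: trivIset_xsection.
Qed.

HB.instance Definition _ := isMeasure.Build
  (measure_prod_display (d, d')) (E * W)%type R annealed
  annealed0 annealed_ge0 annealed_additive.

Let annealed_setT : annealed setT = 1.
Proof.
rewrite /annealed.
under eq_integral do rewrite -setXTT in_xsectionX ?inE// prob_kernel.
by rewrite integral_cst// mul1e; exact: probability_setT.
Qed.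

HB.instance Definition _ := Measure_isProbability.Build
  (measure_prod_display (d, d')) (E * W)%type R annealed annealed_setT.

End Annealed.

(* Main.v *)
From HB Require Import structures.
Require Import Defs.
From mathcomp Require Import all_boot all_order all_algebra.
From mathcomp Require Import all_classical all_reals all_analysis.
From mathcomp Require Import measurable_realfun.
From mathcomp Require Import zify ring lra.
Set Implicit Arguments.
Unset Strict Implicit.
Unset Printing Implicit Defensive.
Import Order.TTheory GRing.Theory Num.Theory.
Import numFieldNormedType.Exports.
Local Open Scope classical_set_scope.
Local Open Scope ring_scope.
Local Open Scope ereal_scope.

(** The formula for the expected passage time holds, with values in the
    extended half-line, without any drift assumption:
      E T_{S_1} = E xi^2 + 2 E[rho xi] E xi (1 + E rho + (E rho)^2 + ...),
    and both parts of the proposition are read off from it.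

    In a fixed environment, P(T_n > k) is the quantity [survival omega n k 0]
    produced by first step analysis ([measure_avoid]), so that the expected
    passage time is the series [mean_passage]. When it is finite, its increments
    D(i) = E_i T_n - E_(i+1) T_n are nonnegative, because a walk cannot reach [n]
    without visiting [i + 1], and they satisfy
      D(i) = 1 + r_i + r_i D(i-1),   r_i = (1 - omega_i) / omega_i.
    In a sparse environment r_i = 1 between two marked sites, hence D grows by 2
    per site there, and a_k = D(S_k) - 1 satisfies
      a_k = rho_(k+1) (2 xi_k + a_(k-1)).
    Iterating this from a_(-m) >= 0 bounds the expected passage time from below by
    the partial sums [block_sum]. Conversely, in [K] steps the walk only sees
    finitely many sites; on these the truncated recursion [crossing] is a
    supersolution of the passage time equation, and it is bounded by the same
    partial sums. Therefore ([mean_passage_sparse])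
      E_omega T_(S_1) = xi_1^2 + sum_(j >= 0) 2 xi_1 rho_1 rho_0 ... rho_(1-j) xi_(-j).

    The annealed expectation is the integral of the quenched one, since T is the
    sum of the indicators of the events T > k ([annealed_passage_time]). In each
    term of the series the variables rho_1 xi_1, rho_0, ..., rho_(1-j), xi_(-j)
    come from different copies, and [integral_prod_independent] gives the
    geometric series above ([expected_passage_time]). It diverges as soon as
    E rho >= 1, because E[rho xi] >= E rho > 0 in this case
    ([speed_of_moments]). *)

(** * Survival probabilities of a nearest-neighbour walk on the integers *)

Section Survival.
Context {R : realType} (omega : int -> R) (n : int).
Local Open Scope ring_scope.

(** [survival omega n k i] is the probability that the walk started at [i] does
    not visit [n] up to time [k], defined through the backward recursion of a
    first step analysis. *)
Fixpoint survival (k : nat) (i : int) : R :=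
  if i == n then 0 else
  if k is k'.+1 then
    omega i * survival k' (i + 1) + (1 - omega i) * survival k' (i - 1)
  else 1.

(** The odds of a step to the left at [i]. *)
Definition odds (i : int) : R := (1 - omega i) / omega i.

(** [crossing m i] is the expected passage time from [i] to [i + 1], obtained by
    unrolling its recursion [m] times from the value [0]. *)
Fixpoint crossing (m : nat) (i : int) : R :=
  if m is m'.+1 then 1 + odds i + odds i * crossing m' (i - 1) else 0.

Hypothesis omega01 : forall i, 0 < omega i < 1.

Let omega_gt0 i : 0 < omega i. Proof. by have /andP[] := omega01 i. Qed.
Let omegaC_gt0 i : 0 < 1 - omega i.
Proof. by have /andP[_] := omega01 i; rewrite subr_gt0. Qed.

Lemma survival_target k : survival k n = 0.
Proof. by case: k => [|k] /=; rewrite eqxx. Qed.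

Lemma survivalS k i : i != n -> survival k.+1 i =
  omega i * survival k (i + 1) + (1 - omega i) * survival k (i - 1).
Proof. by move=> /negPf /= ->. Qed.

Lemma survival_ge0 k i : 0 <= survival k i.
Proof.
elim: k i => [|k IH] i /=; case: ifP => // _.
by rewrite addr_ge0// mulr_ge0// ltW.
Qed.

Lemma survival_le1 k i : survival k i <= 1.
Proof.
elim: k i => [|k IH] i /=; case: ifP => // _.
have := IH (i + 1); have := IH (i - 1).
by have := omega_gt0 i; have := omegaC_gt0 i; nra.
Qed.

Lemma survival_nincr k i : survival k.+1 i <= survival k i.
Proof.
elim: k i => [|k IH] i; have [->|ni] := eqVneq i n; rewrite ?survival_target//.
  by apply: le_trans (survival_le1 _ _) _; rewrite /= (negPf ni).
rewrite [leLHS]survivalS// [leRHS]survivalS//; apply: lerD; apply: ler_wpM2l => //; exact: ltW.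
Qed.

(** On its way to the target the walk from [i] has to visit [i + 1]. *)
Lemma survival_site k i : i < n -> survival k (i + 1) <= survival k i.
Proof.
elim: k i => [|k IH] i lt_in.
  by rewrite /= (lt_eqF lt_in); case: ifP.
rewrite [leRHS]survivalS ?lt_eqF//; apply: (@le_trans _ _ (survival k (i + 1))).
  exact: survival_nincr.
have h1 : survival k i <= survival k (i - 1).
  by have := IH (i - 1); rewrite subrK; apply; lia.
have h2 := IH i lt_in.
have h3 := omegaC_gt0 i.
nra.
Qed.

Lemma sum_survivalS K i : i != n ->
  \sum_(0 <= k < K.+1) survival k i = 1 +
  omega i * (\sum_(0 <= k < K) survival k (i + 1)) +
  (1 - omega i) * (\sum_(0 <= k < K) survival k (i - 1)).
Proof.
move=> ni; rewrite big_nat_recl//= (negPf ni) -addrA !big_distrr -big_split/=.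
by [].
Qed.

Lemma crossing_ge0 m i : 0 <= crossing m i.
Proof.
elim: m i => [|m IH] i //=.
have o0 : 0 <= odds i by rewrite divr_ge0// ltW.
by apply: addr_ge0; [exact: addr_ge0 | exact: mulr_ge0].
Qed.

Let crossingS m i :
  omega i * crossing m.+1 i = 1 + (1 - omega i) * crossing m (i - 1).
Proof. by rewrite /= /odds; field; rewrite gt_eqF. Qed.

(** In [K] steps a walk started at [n - j] stays at or above [n - j - K], hence a
    supersolution of the passage time equation on finitely many sites is enough. *)
Lemma sum_survival_le M K j : (K + j <= M)%N ->
  \sum_(0 <= k < K) survival k (n - j%:Z) <=
  \sum_(0 <= l < j) crossing (M - l) (n - 1 - l%:Z).
Proof.
elim: K j => [|K IH] j leM.
  by rewrite big_geq// sumr_ge0// => l _; exact: crossing_ge0.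
case: j leM => [|j] leM.
  rewrite (big_geq (leqnn 0)) big1// => k _; by rewrite subr0 survival_target.
rewrite sum_survivalS; last by apply/eqP; lia.
have -> : n - j.+1%:Z + 1 = n - j%:Z by lia.
have -> : n - j.+1%:Z - 1 = n - j.+2%:Z by lia.
have h1 := IH j ltac:(lia); have h2 := IH j.+2 ltac:(lia).
rewrite !big_nat_recr//= in h2 *.
have := @crossingS (M - j.+1) (n - 1 - j%:Z).
have -> : (M - j.+1).+1 = (M - j)%N by lia.
have -> : n - 1 - j%:Z - 1 = n - 1 - j.+1%:Z by lia.
have -> : n - j.+1%:Z = n - 1 - j%:Z by lia.
move: (crossing _ _) (crossing _ _) h1 h2 => c1 c2.
move: (\sum_(_ <= _ < _) _) (\sum_(_ <= _ < _) _) (\sum_(_ <= _ < _) _) => s1 s2 s3.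
have := omega_gt0 (n - 1 - j%:Z); have := omegaC_gt0 (n - 1 - j%:Z).
move: (omega _) => w w0 w1 h1 h2 h3.
have : (1 - w) * s1 <= (1 - w) * (s2 + c2 + c1) by rewrite ler_wpM2l// ltW.
have : w * s3 <= w * s2 by rewrite ler_wpM2l// ltW.
lra.
Qed.

(** The expected passage time through [n] from [i], as the sum over [k] of the
    probabilities that it exceeds [k]. *)
Definition mean_passage (i : int) : \bar R :=
  (\sum_(0 <= k <oo) (survival k i)%:E)%E.

Lemma mean_passage_ge0 i : (0 <= mean_passage i)%E.
Proof. by apply: nneseries_ge0 => k _ _; rewrite lee_fin survival_ge0. Qed.

Lemma mean_passage_target : mean_passage n = 0%E.
Proof. by apply: eseries0 => k _ _; rewrite survival_target. Qed.

Lemma mean_passageE i : i != n -> mean_passage i =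
  (1 + ((omega i)%:E * mean_passage (i + 1) +
        (1 - omega i)%:E * mean_passage (i - 1)))%E.
Proof.
move=> ni; rewrite /mean_passage nneseries_recl//; last first.
  by move=> k _; rewrite lee_fin survival_ge0.
rewrite /= (negPf ni); congr (_ + _)%E.
have s0 k j : (0 <= (survival k j)%:E)%E by rewrite lee_fin survival_ge0.
rewrite -!nneseriesZl ?lee_fin ?ltW// -nneseriesD; last 2 first.
- by move=> k _ _; rewrite mule_ge0// lee_fin ltW.
- by move=> k _ _; rewrite mule_ge0// lee_fin ltW.
rewrite -(@nneseries_addn R _ 1)//.
by apply: eq_eseriesr => k _; rewrite addn1 survivalS.
Qed.

Lemma mean_passage_site i : i < n -> (mean_passage (i + 1) <= mean_passage i)%E.
Proof.
move=> lt_in; apply: lee_nneseries => k _; first by rewrite lee_fin survival_ge0.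
by rewrite lee_fin survival_site.
Qed.

(** The passage time equation propagates finiteness to the left, monotonicity
    propagates it to the right. *)
Lemma mean_passage_fin (i0 : int) : i0 < n -> (mean_passage i0 < +oo)%E ->
  forall i, i <= n -> mean_passage i \is a fin_num.
Proof.
move=> i0n fin0 i le_in; rewrite ge0_fin_numE ?mean_passage_ge0//.
have finB i1 : i1 < n -> (mean_passage i1 < +oo)%E ->
    (mean_passage (i1 - 1) < +oo)%E.
  move=> i1n; rewrite mean_passageE ?lt_eqF//.
  have : (0 <= mean_passage (i1 - 1))%E by exact: mean_passage_ge0.
  case: (mean_passage (i1 - 1)%R) => [r| |]//= _; first by rewrite ltry.
  rewrite gt0_muley ?lte_fin// addey ?addey//.
  by rewrite -ltNye (lt_le_trans ltNy0)// mule_ge0 ?mean_passage_ge0// lee_fin ltW.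
have left m : (mean_passage (i0 - m%:Z) < +oo)%E.
  elim: m => [|m IHm]; first by rewrite subr0.
  have -> : i0 - m.+1%:Z = i0 - m%:Z - 1 by lia.
  by apply: finB => //; lia.
have right m : i0 + m%:Z <= n -> (mean_passage (i0 + m%:Z) < +oo)%E.
  elim: m => [|m IHm] le_m; first by rewrite addr0.
  have -> : i0 + m.+1%:Z = i0 + m%:Z + 1 by lia.
  apply: le_lt_trans (IHm _); last by lia.
  by apply: mean_passage_site; lia.
have [le_i|lt_i] := leP i i0.
  have -> : i = i0 - `|i0 - i|%N%:Z by lia.
  exact: left.
have -> : i = i0 + `|i - i0|%N%:Z by lia.
by apply: right; lia.
Qed.

(** If the expected passage time is finite, its increments solve exactly the
    recursion whose truncations are [crossing m]. *)
Lemma mean_passage_increments (i0 : int) : i0 < n -> (mean_passage i0 < +oo)%E ->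
  exists D : int -> R, [/\ forall i, i < n -> 0 <= D i,
    forall i, i < n -> D i = 1 + odds i + odds i * D (i - 1) &
    forall j : nat, mean_passage (n - j%:Z) =
      (\sum_(0 <= l < j) D (n - 1 - l%:Z))%:E].
Proof.
move=> i0n fin0; have fin := mean_passage_fin i0n fin0.
pose G i := fine (mean_passage i).
have GE i : i <= n -> mean_passage i = (G i)%:E by move=> ?; rewrite fineK ?fin.
exists (fun i : int => G i - G (i + 1)); split => [i lt_in|i lt_in|j].
- rewrite subr_ge0 -lee_fin -(GE _ (ltW lt_in)) -GE; last by lia.
  exact: mean_passage_site.
- have := @mean_passageE i; rewrite lt_eqF// !GE; [|lia..].
  move=> /(_ isT); rewrite -!EFinM -!EFinD => -[Gi].
  rewrite subrK Gi /odds; field => //.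
  by rewrite gt_eqF.
- elim: j => [|j IH]; first by rewrite subr0 big_geq// mean_passage_target.
  rewrite big_nat_recr//= EFinD -IH !GE; [|lia..].
  rewrite -EFinD; congr (_%:E).
  have -> : n - j.+1%:Z = n - 1 - j%:Z by lia.
  have -> : n - 1 - j%:Z + 1 = n - j%:Z by lia.
  ring.
Qed.

End Survival.

(** * The passage time through the first marked site of a fixed environment *)

Section MarkedSites.
Context {R : realType} (z : int -> nat * R).
Local Open Scope ring_scope.

Lemma marked_sites0 : marked_sites z 0 = 0.
Proof. by rewrite /marked_sites /= big_geq. Qed.

Lemma marked_sites1 : marked_sites z 1 = (z 1).1%:Z.
Proof. by rewrite /marked_sites /= big_nat1. Qed.

Lemma marked_sitesS (k : int) : marked_sites z (k + 1) = marked_sites z k + (z (k + 1)).1%:Z.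
Proof.
rewrite /marked_sites; case: k => [m|[|m]] /=.
- by rewrite -PoszD addn1 /= big_nat_recr.
- by rewrite !big_nat1 big_geq// addrC subrr.
- have -> : Negz m.+1 + 1 = Negz m :> int by lia.
  rewrite [in RHS]big_nat_recr//= opprD.
  have -> : Negz m = - m.+1%:Z by lia.
  by rewrite subn1 subrK.
Qed.

Hypothesis z_gt0 : forall k, (0 < (z k).1)%N.

Lemma marked_sites_lt : {homo marked_sites z : k l / k < l}.
Proof.
move=> k l lt_kl; have -> : l = k + `|l - k|.-1.+1%:Z by lia.
elim: `|l - k|.-1 => [|p IH].
  by rewrite marked_sitesS; have := z_gt0 (k + 1); lia.
apply: (lt_trans IH).
have -> : k + p.+2%:Z = k + p.+1%:Z + 1 by lia.
by rewrite marked_sitesS; have := z_gt0 (k + p.+1%:Z + 1); lia.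
Qed.

Lemma marked_sites_inj : injective (marked_sites z).
Proof.
by move=> k l; have [/marked_sites_lt|/marked_sites_lt|//] := ltgtP k l; lia.
Qed.

Lemma sparse_env_marked (k : int) : sparse_env z (marked_sites z k) = lambda (z (k + 1)).
Proof.
rewrite /sparse_env; case: pselect => [H|[]]; last by exists k.
by case: cid => l /= /marked_sites_inj ->.
Qed.

Lemma sparse_env_between (k : int) (r : nat) : (0 < r)%N -> (r < (z (k + 1)).1)%N ->
  sparse_env z (marked_sites z k + r%:Z) = 2^-1.
Proof.
move=> r0 rz; rewrite /sparse_env; case: pselect => // -[l Sl]; exfalso.
have [lk|kl|lk] := ltgtP l k.
- by have := marked_sites_lt lk; lia.
- have [e|k1l|] := ltgtP (k + 1) l.
  + by have := marked_sites_lt e; rewrite marked_sitesS; lia.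
  + by lia.
  + by move=> e; move: Sl; rewrite -e marked_sitesS; lia.
- by move: Sl; rewrite lk; lia.
Qed.

Lemma sparse_env01 i : (forall k, 0 < lambda (z k) < 1) -> 0 < sparse_env z i < 1.
Proof.
by move=> z01; rewrite /sparse_env; case: pselect => // _; apply/andP; split; lra.
Qed.

End MarkedSites.

Section SparsePassage.
Context {R : realType} (z : int -> nat * R).
Local Open Scope ring_scope.
Hypothesis z_gt0 : forall k, (0 < (z k).1)%N.
Hypothesis z01 : forall k, 0 < lambda (z k) < 1.

Local Notation S := (marked_sites z).
Local Notation omega := (sparse_env z).
Local Notation n := (marked_sites z 1).

Let omega01 i : 0 < omega i < 1. Proof. exact: sparse_env01. Qed.

Lemma rho_gt0 k : 0 < rho (z k).
Proof. by have /andP[? ?] := z01 k; rewrite divr_gt0// subr_gt0. Qed.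

Lemma odds_marked (k : int) : odds omega (S k) = rho (z (k + 1)).
Proof. by rewrite /odds sparse_env_marked. Qed.

Lemma odds_between (k : int) (r : nat) : (0 < r)%N -> (r < (z (k + 1)).1)%N ->
  odds omega (S k + r%:Z) = 1.
Proof. by move=> r0 rz; rewrite /odds sparse_env_between//; field. Qed.

(** The expected time that the excursions to the block between [S (k - j - 1)] and
    [S (k - j)] add to the passage from [S k] to [S k + 1]. *)
Definition block_term (k : int) (j : nat) : R :=
  (\prod_(0 <= i < j.+1) rho (z (k + 1 - i%:Z))) * (2 * xi (z (k - j%:Z))).

(** [1 + block_sum m k] is the expected passage time from [S k] to [S k + 1],
    truncated to the [m] nearest blocks on the left of [S k]. *)
Definition block_sum (m : nat) (k : int) : R := \sum_(0 <= j < m) block_term k j.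

Lemma block_term_ge0 k j : 0 <= block_term k j.
Proof.
by rewrite mulr_ge0 ?mulr_ge0 ?prodr_ge0// => i _; rewrite ltW// rho_gt0.
Qed.

Lemma block_sumS m (k : int) : block_sum m.+1 k =
  rho (z (k + 1)) * (2 * xi (z k) + block_sum m (k - 1)).
Proof.
rewrite /block_sum big_nat_recl// mulrDr big_distrr/=; congr (_ + _).
  by rewrite /block_term big_nat1 !subr0.
apply: eq_bigr => j _; rewrite /block_term big_nat_recl// subr0 -mulrA.
congr (_ * (_ * (2 * xi (z _)))); last by lia.
by apply: eq_bigr => i _; congr (rho (z _)); lia.
Qed.

Lemma block_sum_nondecr m1 m2 k : (m1 <= m2)%N -> block_sum m1 k <= block_sum m2 k.
Proof.
move=> le_m; rewrite /block_sum [leRHS](big_cat_nat (n := m1))//= lerDl.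
by apply: sumr_ge0 => j _; exact: block_term_ge0.
Qed.

(** The last site of the block preceding [S k]. *)
Let before (k : int) : S k - 1 = S (k - 1) + (z k).1.-1%:Z.
Proof. by have := marked_sitesS z (k - 1); have := z_gt0 k; rewrite subrK; lia. Qed.

Lemma crossing_le_block_sum m (k : int) (r : nat) : (r < (z (k + 1)).1)%N ->
  crossing omega m (S k + r%:Z) <= 1 + block_sum m k + 2 * r%:R.
Proof.
elim: m k r => [|m IH] k r rz.
  rewrite /block_sum big_geq//= addr0; have : 0 <= r%:R :> R by []; lra.
have mono := block_sum_nondecr k (leqnSn m).
case: r rz => [|r] rz /=.
  rewrite addr0 odds_marked before.
  have := @IH (k - 1) (z k).1.-1.
  rewrite subrK => /(_ ltac:(have := z_gt0 k; lia)) le_c.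
  have := rho_gt0 (k + 1).
  move: le_c; rewrite block_sumS.
  have -> : 2 * (z k).1.-1%:R = 2 * xi (z k) - 2 :> R.
    by rewrite /xi -[in RHS](prednK (z_gt0 k)) -[in RHS]natr1; ring.
  move: (crossing _ _ _) => c; nra.
rewrite odds_between//.
have -> : S k + r.+1%:Z - 1 = S k + r%:Z by lia.
have := IH k r (ltnW rz).
rewrite -natr1; lra.
Qed.

Let target_gt0 : 0 < n.
Proof. by have := z_gt0 1; rewrite marked_sites1. Qed.

Let sum_block (a : R) (x : nat) :
  \sum_(0 <= l < x) (1 + a + 2 * (x - 1 - l)%:R) = x%:R ^+ 2 + x%:R * a.
Proof.
rewrite big_nat_rev/= add0n.
rewrite (@eq_big_nat _ _ _ _ _ _ (fun l => 1 + a + 2 * l%:R)); last first.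
  by move=> l /andP[_ lx]; congr (_ + _ * _%:R); lia.
elim: x => [|x IH]; first by rewrite big_geq// expr0n mul0r addr0.
by rewrite big_nat_recr//= IH -natr1; ring.
Qed.

Lemma mean_passage_le (K : nat) :
  \sum_(0 <= k < K) survival omega n k 0 <=
  xi (z 1) ^+ 2 + xi (z 1) * block_sum (K + (z 1).1) 0.
Proof.
have := sum_survival_le n omega01 (leqnn (K + (z 1).1)).
rewrite {2}marked_sites1 subrr => /le_trans; apply.
rewrite -sum_block ler_sum_nat// => l /andP[_ lx].
have -> : n - 1 - l%:Z = S 0 + ((z 1).1 - 1 - l)%N%:Z.
  by rewrite marked_sites0 marked_sites1; lia.
apply: le_trans (crossing_le_block_sum _ _) _; first by rewrite add0r; lia.
by rewrite lerD2r lerD2l block_sum_nondecr// leq_subr.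
Qed.

Lemma mean_passage_ge (m : nat) :
  ((xi (z 1) ^+ 2 + xi (z 1) * block_sum m 0)%:E <= mean_passage omega n 0)%E.
Proof.
have [->|] := eqVneq (mean_passage omega n 0) +oo%E; first exact: leey.
rewrite -ltey => fin0.
have [D [D_ge0 D_rec D_sum]] := mean_passage_increments omega01 target_gt0 fin0.
have lt_S (k : int) (r : nat) : k <= 0 -> (r < (z (k + 1)).1)%N -> S k + r%:Z < n.
  move=> k0 rz; have : S (k + 1) <= n.
    have [->|?] := eqVneq k 0; first by [].
    by apply/ltW/marked_sites_lt => //; lia.
  by rewrite marked_sitesS; lia.
(* The increments grow by 2 per site inside a block. *)
have D_block (k : int) (r : nat) : k <= 0 -> (r < (z (k + 1)).1)%N ->
    D (S k + r%:Z) = D (S k) + 2 * r%:R.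
  move=> k0; elim: r => [|r IH] rz; first by rewrite mulr0 !addr0.
  rewrite D_rec ?lt_S// odds_between//.
  have -> : S k + r.+1%:Z - 1 = S k + r%:Z by lia.
  by rewrite IH ?(ltnW rz)// -natr1; ring.
have D_marked (k : int) : k <= 0 -> D (S k) =
    1 + rho (z (k + 1)) + rho (z (k + 1)) * (D (S (k - 1)) + 2 * xi (z k) - 2).
  move=> k0; rewrite D_rec; last by have := @lt_S k 0%N k0 (z_gt0 _); rewrite addr0.
  rewrite odds_marked before D_block; [|lia|rewrite subrK; have := z_gt0 k; lia].
  by rewrite /xi -[in RHS](prednK (z_gt0 k)) -[in RHS]natr1; ring.
have D_ge p (k : int) : k <= 0 -> 1 + block_sum p k <= D (S k).
  elim: p k => [|p IH] k k0; rewrite D_marked//.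
    rewrite /block_sum big_geq// addr0 -addrA lerDl addr_ge0 ?(ltW (rho_gt0 _))//.
    rewrite mulr_ge0 ?(ltW (rho_gt0 _))// -addrA addr_ge0//.
      by apply: D_ge0; have := @lt_S (k - 1) 0%N; rewrite addr0; apply => //; lia.
    by rewrite /xi subr_ge0 -[leLHS]mulr1 ler_pM2l// ler1n.
  have := IH (k - 1); rewrite block_sumS => /(_ ltac:(lia)).
  have := rho_gt0 (k + 1); nra.
have -> : mean_passage omega n 0 = (\sum_(0 <= l < (z 1).1) D (n - 1 - l%:Z))%:E.
  by rewrite -D_sum [in n - _]marked_sites1 subrr.
rewrite lee_fin -sum_block ler_sum_nat// => l /andP[_ lx].
have -> : n - 1 - l%:Z = S 0 + ((z 1).1 - 1 - l)%N%:Z.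
  by rewrite marked_sites0 marked_sites1; lia.
by rewrite D_block ?add0r//; [rewrite lerD2r D_ge | lia].
Qed.

(** The quenched expectation of the passage time; both sides may be infinite. *)
Lemma mean_passage_sparse : mean_passage omega n 0 =
  ((xi (z 1) ^+ 2)%:E + \sum_(0 <= j <oo) (xi (z 1) * block_term 0 j)%:E)%E.
Proof.
have x0 : 0 <= xi (z 1) :> R by [].
have t0 j : (0 <= (xi (z 1) * block_term 0 j)%:E)%E.
  by rewrite lee_fin mulr_ge0// block_term_ge0.
have sumE m : ((xi (z 1) * block_sum m 0)%:E =
    \sum_(0 <= j < m) (xi (z 1) * block_term 0 j)%:E)%E.
  by rewrite sumEFin /block_sum big_distrr.
apply/eqP; rewrite eq_le; apply/andP; split.
  apply: lime_le.
    by apply: is_cvg_nneseries => k _ _; rewrite lee_fin survival_ge0.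
  near=> K; rewrite sumEFin.
  apply: le_trans (_ : _ <= (xi (z 1) ^+ 2 +
                       xi (z 1) * block_sum (K + (z 1).1) 0)%:E)%E _.
    by rewrite lee_fin mean_passage_le.
  by rewrite EFinD leeD2l// sumE; apply: nneseries_lim_ge.
rewrite -leeBrDl//; apply: lime_le; first exact: is_cvg_nneseries.
near=> m; rewrite -sumE leeBrDl// -EFinD; exact: mean_passage_ge.
Unshelve. all: by end_near.
Qed.

End SparsePassage.

(** * The law of the passage times in a fixed environment *)

Section Quenched.
Context {d : measure_display} {W : measurableType d} {R : realType}.
Context (omega : int -> R) (X : nat -> W -> int).
Context (Q : {measure set W -> \bar R}).
Local Open Scope ring_scope.
Hypothesis mX : forall m i, measurable [set x | X m x = i].
Hypothesis Q1 : Q setT = 1%E.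
Hypothesis walk : is_walk_in_env omega X Q.

(** The paths that follow [p] up to time [l]. *)
Let cylinder (p : nat -> int) (l : nat) : set W :=
  [set x | forall m, (m <= l)%N -> X m x = p m].

(** The paths that avoid [n] from time [l] to time [l + r]. *)
Let avoids (n : int) (l r : nat) : set W :=
  [set x | forall m, (l <= m <= l + r)%N -> X m x <> n].

(** The path that follows [p] up to time [l] and then sits at [j]. *)
Let extend (p : nat -> int) (l : nat) (j : int) (m : nat) : int :=
  if (m <= l)%N then p m else j.

Let measurable_cylinder p l : measurable (cylinder p l).
Proof.
rewrite (_ : cylinder p l = \bigcap_(m in [set m | (m <= l)%N]) [set x | X m x = p m]).
  by apply: bigcap_measurable; [exists 0%N | move=> m _; exact: mX].
by apply/seteqP; split => x /= h m /h.
Qed.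

Let measurable_avoids n l r : measurable (avoids n l r).
Proof.
rewrite (_ : avoids n l r =
    \bigcap_(m in [set m | (l <= m <= l + r)%N]) ~` [set x | X m x = n]).
  apply: bigcap_measurable; first by exists l => /=; lia.
  by move=> m _; apply: measurableC; exact: mX.
by apply/seteqP; split => x /= h m /h.
Qed.

Let fin_num_Q (A : set W) : measurable A -> Q A \is a fin_num.
Proof.
move=> mA; rewrite ge0_fin_numE//; apply: le_lt_trans (ltry 1).
by rewrite -Q1 le_measure ?inE.
Qed.

Let measureQDI A B : measurable A -> measurable B ->
  Q A = (Q (A `\` B) + Q (A `&` B))%E.
Proof. exact: measureDI. Qed.

Let measureQU A B : measurable A -> measurable B -> A `&` B = set0 ->
  Q (A `|` B) = (Q A + Q B)%E.
Proof. by move=> mA mB AB0; exact: measureU. Qed.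

Let cylinder_extend p l j : cylinder (extend p l j) l.+1 =
  cylinder p l `&` [set x | X l.+1 x = j].
Proof.
apply/seteqP; split => x /=.
  move=> h; split; last by rewrite h// /extend ltnn.
  by move=> m ml; rewrite h ?(leq_trans ml)// /extend ml.
move=> [h hj] m; rewrite leq_eqVlt => /orP[/eqP ->|]; last first.
  by rewrite ltnS /extend => ml; rewrite ml h.
by rewrite /extend ltnn.
Qed.

Let measure_extend p l j : Q (cylinder (extend p l j) l.+1) =
  (Q (cylinder p l) * (step_prob omega (p l) j)%:E)%E.
Proof.
have [_ /(_ l (extend p l j))] := walk.
rewrite /extend leqnn ltnn => ->; congr (Q _ * _)%E.
by apply/seteqP; split => x /= h m ml; move: (h m ml); rewrite ml.
Qed.

Let step_up i : step_prob omega i (i + 1) = omega i.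
Proof. by rewrite /step_prob eqxx. Qed.

Let step_down i : step_prob omega i (i - 1) = 1 - omega i.
Proof. by rewrite /step_prob ifF ?eqxx//; apply/eqP; lia. Qed.

(** Almost surely a path moves to one of the two neighbours of its position. *)
Let measure_step p l (A : set W) : measurable A -> A `<=` cylinder p l ->
  Q A = (Q (A `&` [set x | X l.+1 x = (p l + 1)%R]) +
         Q (A `&` [set x | X l.+1 x = (p l - 1)%R]))%E.
Proof.
move=> mA Acyl.
pose U := [set x | X l.+1 x = p l + 1].
pose D := [set x | X l.+1 x = p l - 1].
have mU : measurable U by exact: mX.
have mD : measurable D by exact: mX.
have UD0 (B : set W) : B `&` U `&` (B `&` D) = set0.
  by apply/seteqP; split => // x [[_ Ux] [_ Dx]]; move: Ux; rewrite /U/= Dx; lia.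
have null : Q (cylinder p l `\` (U `|` D)) = 0%E.
  have mC := measurable_cylinder p l; have mUD := measurableU _ _ mU mD.
  have := measureQDI mC mUD.
  rewrite [in X in (_ + X)%E]setIUr measureQU; [|exact: measurableI..|exact: UD0].
  rewrite -!cylinder_extend !measure_extend step_up step_down.
  have := fin_num_Q mC; have := fin_num_Q (measurableD mC mUD).
  case: (Q _) => // q _; case: (Q _) => // c _.
  by rewrite -!EFinM -!EFinD => -[qc]; congr (_%:E); lra.
have mUD : measurable (U `|` D) by exact: measurableU.
rewrite (measureQDI mA mUD) [X in (X + _)%E](_ : _ = 0%E) ?add0e.
  by rewrite setIUr measureQU//; exact: measurableI.
apply: (subset_measure0 _ _ _ null); [exact: measurableD..|exact: setSD].
Qed.

Let measure_cylinder_avoids n r p l :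
  Q (cylinder p l `&` avoids n l r) = (Q (cylinder p l) * (survival omega n r (p l))%:E)%E.
Proof.
elim: r p l => [|r IH] p l; have [pn|pn] := eqVneq (p l) n.
- rewrite pn survival_target mule0 (_ : _ `&` _ = set0)// -subset0 => x [/= h1 h2].
  by apply: (h2 l); [lia | rewrite h1].
- rewrite /= (negPf pn) mule1; congr (Q _); apply/seteqP; split => x; first by case.
  move=> h; split => // m /= ml; have -> : m = l by lia.
  by rewrite h//; apply/eqP.
- rewrite pn survival_target mule0 (_ : _ `&` _ = set0)// -subset0 => x [/= h1 h2].
  by apply: (h2 l); [lia | rewrite h1].
have split_at j : cylinder p l `&` avoids n l r.+1 `&` [set x | X l.+1 x = j] =
    cylinder (extend p l j) l.+1 `&` avoids n l.+1 r.
  rewrite cylinder_extend; apply/seteqP; split => x /=.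
    move=> [[h1 h2] h3]; split => // m mr; apply: h2; lia.
  move=> [[h1 h3] h2]; split => //; split => // m mr.
  have [->|?] := eqVneq m l; first by rewrite h1//; apply/eqP.
  by apply: h2; lia.
rewrite (@measure_step p l); [|exact: measurableI|exact: subIsetl].
rewrite !split_at !IH !measure_extend /extend ltnn step_up step_down survivalS//.
have := fin_num_Q (measurable_cylinder p l).
by case: (Q _) => // q _; rewrite -!EFinM -EFinD; congr (_%:E); ring.
Qed.

Lemma measure_avoid n k :
  Q [set x | forall m, (m <= k)%N -> X m x <> n] = (survival omega n k 0)%:E.
Proof.
have := @measure_cylinder_avoids n k (fun=> 0) 0.
set Z := cylinder _ _; set A := [set x | _].
have QZ : Q Z = 1%E.
  have [<- _] := walk; congr (Q _); apply/seteqP; split => x /=; first by apply.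
  by move=> h m; rewrite leqn0 => /eqP ->.
have AE : A = avoids n 0 k.
  by apply/seteqP; split => x /= h m mk; apply: h; lia.
have mZ : measurable Z by exact: measurable_cylinder.
have mA : measurable A by rewrite AE; exact: measurable_avoids.
have QZC : Q (~` Z) = 0%E.
  have := measureQDI measurableT mZ; rewrite setTI QZ Q1 setTD.
  have := fin_num_Q (measurableC mZ).
  by case: (Q _) => // q _; rewrite -EFinD => -[q1]; congr (_%:E); lra.
rewrite QZ mul1e -AE => <-.
rewrite (measureQDI mA mZ) [X in (X + _)%E](_ : _ = 0%E) ?add0e 1?setIC//.
apply: (subset_measure0 _ _ _ QZC); [exact: measurableD|exact: measurableC|].
by move=> x [].
Qed.

End Quenched.

(** * Integrating the passage time under the annealed law *)

Lemma nneseries_ge_cst (R : realType) (u : nat -> \bar R) (c : R) :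
  (0 < c)%R -> (forall k, c%:E <= u k) -> \sum_(0 <= k <oo) u k = +oo.
Proof.
move=> c0 cu; have u0 k : 0 <= u k.
  by apply: le_trans (cu k); rewrite lee_fin ltW.
apply/eqyP => A A0; pose N := (Num.truncn (A / c)).+1.
apply: (@le_trans _ _ (\sum_(0 <= k < N) u k)); last exact: nneseries_lim_ge.
apply: (@le_trans _ _ (\sum_(0 <= k < N) c%:E)); last exact: lee_sum.
rewrite sumEFin lee_fin sumr_const_nat subn0 -mulr_natl -ler_pdivrMr//.
by rewrite ltW// truncnS_gt.
Qed.

(** Both sides are infinite if [n] is never visited. *)
Lemma passage_time_series (R : realType) (d : measure_display) (W : measurableType d)
    (X : nat -> W -> int) (n : int) (x : W) :
  passage_time X n x =
  \sum_(0 <= k <oo) (\1_[set y | forall m, (m <= k)%N -> X m y <> n] x)%:E :> \bar R.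
Proof.
have i0 k : 0 <= (\1_[set y | forall m, (m <= k)%N -> X m y <> n] x)%:E :> \bar R.
  by rewrite lee_fin.
have [hit|nohit] := pselect (exists k, X k x == n); last first.
  rewrite (@nneseries_ge_cst R _ 1)//.
    rewrite /passage_time (_ : [set _ | _ in _] = set0) ?ereal_inf0//.
    rewrite -subset0 => _ [k /= Xk _]; apply: nohit; exists k; exact/eqP.
  move=> k; rewrite indicE mem_set// => m _ Xm; apply: nohit; exists m; exact/eqP.
case: (ex_minnP hit) => K /eqP XK minK.
rewrite (@nneseries_split R _ 0 K)// eseries0 ?adde0; last first.
  move=> k; rewrite add0n => Kk _; rewrite indicE memNset// => /(_ K Kk); exact.
rewrite add0n (eq_big_nat _ _ (F2 := fun=> 1%:E)); last first.
  move=> k kK; rewrite indicE mem_set// => m mk Xm.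
  by have := minK m; rewrite Xm eqxx => /(_ isT); lia.
rewrite sumEFin sumr_const_nat subn0; apply/eqP; rewrite eq_le; apply/andP; split.
  by apply: ereal_inf_lbound; exists K.
apply: le_ereal_inf_tmp => _ [k /= Xk <-]; rewrite lee_fin ler_nat minK//; exact/eqP.
Qed.

Section AnnealedPassage.
Context {d d' : measure_display} {E : measurableType d} {W : measurableType d'}
  {R : realType}.
Context (P : probability E R) (Pq : R.-pker E ~> W).
Context (X : nat -> W -> int) (N : E -> nat).
Hypothesis mX : forall m i, measurable [set x | X m x = i].
Hypothesis mN : forall i, measurable [set e | N e = i].

Let late (k : nat) : set (E * W) :=
  [set ex | forall m, (m <= k)%N -> X m ex.2 <> (N ex.1)%:Z].

Let measurable_late k : measurable (late k).
Proof.
rewrite (_ : late k = \bigcap_(m in [set m | (m <= k)%N])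
    ~` \bigcup_i ([set e | N e = i] `*` [set x | X m x = i])).
  apply: bigcap_measurable; first by exists 0%N.
  move=> m _; apply/measurableC/bigcupT_measurable => i.
  exact: measurableX.
apply/seteqP; split => [[e x] /= h m mk [i _ /= [Ni Xi]]|[e x] /= h m mk XN].
  by apply: (h m mk); rewrite Xi Ni.
by apply: (h m mk); exists (N e).
Qed.

Let xsection_late k e :
  xsection (late k) e = [set x | forall m, (m <= k)%N -> X m x <> (N e)%:Z].
Proof. by apply/seteqP; split => x; rewrite /xsection/= inE. Qed.

Lemma measurable_avoid k :
  measurable_fun setT (fun e => Pq e [set x | forall m, (m <= k)%N -> X m x <> (N e)%:Z]).
Proof.
under eq_fun do rewrite -xsection_late; rewrite -kfcompkindic//.
apply: measurable_kfcomp => //; first exact/measurable_EFinP/measurable_indic.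
by move=> t; rewrite lee_fin.
Qed.

Lemma annealed_passage_time :
  \int[annealed P Pq]_ex passage_time X (N ex.1)%:Z ex.2 =
  \int[P]_e \sum_(0 <= k <oo) Pq e [set x | forall m, (m <= k)%N -> X m x <> (N e)%:Z].
Proof.
transitivity (\int[annealed P Pq]_ex \sum_(0 <= k <oo) (\1_(late k) ex)%:E).
  apply: eq_integral => -[e x] _; rewrite passage_time_series.
  by apply: eq_eseriesr => k _; rewrite !indicE; congr ((_ : bool)%:R)%:E.
rewrite integral_nneseries//; last first.
  by move=> k; exact/measurable_EFinP/measurable_indic.
rewrite integral_nneseries//; last exact: measurable_avoid.
apply: eq_eseriesr => k _; rewrite integral_indic// setIT.
by apply: eq_integral => e _; rewrite xsection_late.
Qed.

End AnnealedPassage.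

(** * Expectation of a product of functions of independent variables *)

Section Weighted.
Context {d d' : measure_display} {T : measurableType d} {U : measurableType d'}
  {R : realType} (P : probability T R).
Import HBNNSimple.

(** Monotonicity covers the case [c = +oo]. *)
Lemma cvg_mule_nondecreasing (c : \bar R) (a : nat -> \bar R) :
  0 <= c -> (forall n, 0 <= a n) -> nondecreasing_seq a ->
  (fun n => c * a n) @ \oo --> c * ereal_sup (range a).
Proof.
move=> c0 a0 nd_a; have a_le n : a n <= ereal_sup (range a).
  by apply: ereal_sup_ubound; exists n.
have := ereal_nondecreasing_cvgn nd_a; move: c0.
case: c => [r| |//] c0 cvg_a; first exact: cvgeZl.
have [alla0|] := pselect (forall n, a n = 0).
  rewrite (_ : range a = [set 0]); last first.
    apply/seteqP; split => [_ [n _ <-]/=|_ ->]; first by rewrite alla0.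
    by exists 0%N.
  rewrite ereal_sup1 mule0 (_ : (fun n => _) = cst 0); first exact: cvg_cst.
  by apply/funext => n /=; rewrite alla0 mule0.
move=> /existsNP[N /eqP aN0].
have aN : 0 < a N by rewrite lt0e aN0 a0.
rewrite gt0_mulye ?(lt_le_trans aN)//; apply: cvg_near_cst.
near=> n; rewrite gt0_mulye// (lt_le_trans aN)// nd_a//.
by near: n; exists N.
Unshelve. all: by end_near. Qed.

(** If the weighted measure [Y . P], restricted to [B], gives the events of [Z]
    the mass [c . P], then so it does for nonnegative functions of [Z]. *)
Lemma ge0_integral_weighted (B : set T) (Y : T -> R) (Z : T -> U) (c : \bar R)
    (f : U -> R) :
  measurable B -> measurable_fun setT Y -> (forall x, (0 <= Y x)%R) ->
  measurable_fun setT Z -> 0 <= c ->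
  (forall A, measurable A ->
    \int[P]_(x in B `&` Z @^-1` A) (Y x)%:E = c * P (Z @^-1` A)) ->
  measurable_fun setT f -> (forall u, (0 <= f u)%R) ->
  \int[P]_(x in B) (Y x * f (Z x))%:E = c * \int[P]_x (f (Z x))%:E.
Proof.
move=> mB mY Y0 mZ c0 YA mf f0.
have mfE : measurable_fun setT (EFin \o f) by exact/measurable_EFinP.
pose h := nnsfun_approx measurableT mfE.
have mh n : measurable_fun setT (fun x => h n (Z x)).
  by apply: (measurableT_comp (f := h n)).
have h_cvg x : (h n (Z x))%:E @[n --> \oo] --> (f (Z x))%:E.
  by apply: (cvg_nnsfun_approx measurableT mfE) => // u _; rewrite lee_fin.
have h_nd x : {homo (fun n => (h n (Z x))%:E) : m n / (m <= n)%N >-> m <= n}.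
  by move=> m n mn; rewrite lee_fin; exact/lefP/nd_nnsfun_approx.
have simple n : \int[P]_(x in B) (Y x * h n (Z x))%:E = c * \int[P]_x (h n (Z x))%:E.
  have mpre r : measurable (Z @^-1` (h n @^-1` [set r])).
    by rewrite -[X in measurable X]setTI; apply: mZ.
  have r0 r x : 0 <= (r * \1_(h n @^-1` [set r]) (Z x))%:E.
    exact: nnfun_muleindic_ge0.
  have m1 r : measurable_fun setT (fun x => \1_(h n @^-1` [set r]) (Z x) : R).
    apply: (@measurableT_comp _ _ _ _ _ _ (\1_(h n @^-1` [set r]) : U -> R)) => //.
  have mr r : measurable_fun setT (fun x => (r * \1_(h n @^-1` [set r]) (Z x))%R).
    exact: measurable_funM.
  transitivity (\sum_(r \in range (h n))
      \int[P]_(x in B) ((Y x)%:E * (r * \1_(h n @^-1` [set r]) (Z x))%:E)).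
    rewrite -ge0_integral_fsum//; last 2 first.
    - move=> r; apply: measurable_funTS; apply: emeasurable_funM;
        exact/measurable_EFinP.
    - by move=> r x _; rewrite mule_ge0// lee_fin.
    apply: eq_integral => x _; rewrite EFinM [in LHS]fimfunE -fsumEFin//.
    by rewrite ge0_mule_fsumr.
  under [in RHS]eq_integral do rewrite fimfunE -fsumEFin//.
  rewrite [in RHS]ge0_integral_fsum//; last by move=> r; exact/measurable_EFinP.
  rewrite ge0_mule_fsumr; last by move=> r; exact: integral_ge0.
  apply: eq_fsbigr => r; rewrite inE => -[u _ hr].
  have r_ge0 : (0 <= r)%R by rewrite -hr.
  under [in LHS]eq_integral do rewrite EFinM muleCA.
  under [in RHS]eq_integral do rewrite EFinM.
  rewrite [in RHS]ge0_integralZl//; last exact/measurable_EFinP.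
  rewrite [in LHS]ge0_integralZl//; last 2 first.
  - by apply: measurable_funTS; apply: emeasurable_funM; exact/measurable_EFinP.
  - by move=> x _; rewrite mule_ge0 ?lee_fin.
  rewrite [RHS]muleCA; congr (_ * _).
  transitivity (c * P (Z @^-1` (h n @^-1` [set r]))).
    rewrite -YA// integral_mkcondr; apply: eq_integral => x _.
    by rewrite epatch_indic/=.
  congr (_ * _); rewrite (_ : (fun x => _) =
    (fun x => (\1_(Z @^-1` (h n @^-1` [set r])) x)%:E)).
    by rewrite integral_indic// setIT.
  by apply/funext => x; rewrite !indicE; congr ((_ : bool)%:R)%:E.
have -> : \int[P]_(x in B) (Y x * f (Z x))%:E =
    limn (fun n => \int[P]_(x in B) (Y x * h n (Z x))%:E).
  rewrite -monotone_convergence//.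
  - apply: eq_integral => x _; apply/esym/cvg_lim => //.
    rewrite EFinM; under eq_fun do rewrite EFinM.
    by apply: cvgeZl.
  - by move=> n; apply/measurable_EFinP/measurable_funTS; exact: measurable_funM.
  - by move=> n x _; rewrite lee_fin mulr_ge0.
  - by move=> x _ m n mn; rewrite !EFinM lee_wpmul2l ?lee_fin//; exact: h_nd.
have nd_int : nondecreasing_seq (fun n => \int[P]_x (h n (Z x))%:E).
  move=> m n mn; apply: ge0_le_integral => //.
  - by move=> x _; rewrite lee_fin.
  - exact/measurable_EFinP.
  - exact/measurable_EFinP.
  - by move=> x _; exact: h_nd.
rewrite (congr_lim (funext simple)); apply/cvg_lim => //.
have -> : \int[P]_x (f (Z x))%:E = ereal_sup (range (fun n => \int[P]_x (h n (Z x))%:E)).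
  rewrite -(cvg_lim _ (ereal_nondecreasing_cvgn nd_int))//.
  rewrite -monotone_convergence//.
  - by apply: eq_integral => x _; apply/esym/cvg_lim.
  - by move=> n; exact/measurable_EFinP.
  - by move=> n x _; rewrite lee_fin.
apply: cvg_mule_nondecreasing => // n.
by apply: integral_ge0 => x _; rewrite lee_fin.
Qed.

Lemma measurable_bigcap_preimage (Z : int -> T -> U) (A : int -> set U)
    (s : seq int) : (forall k, measurable_fun setT (Z k)) ->
  (forall k, measurable (A k)) ->
  measurable (\bigcap_(k in [set` s]) (Z k @^-1` A k)).
Proof.
move=> mZ mA; rewrite bigcap_seq; apply: bigsetI_measurable => k _.
by rewrite -[X in measurable X]setTI; apply: mZ.
Qed.

Lemma integral_prod_independent (Z : int -> T -> U) (f : int -> U -> R)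
    (s : seq int) :
  (forall k, measurable_fun setT (Z k)) -> mutually_independent P Z ->
  (forall k, measurable_fun setT (f k)) -> (forall k u, (0 <= f k u)%R) ->
  uniq s ->
  \int[P]_x (\prod_(k <- s) f k (Z k x))%:E =
  \prod_(k <- s) \int[P]_x (f k (Z k x))%:E.
Proof.
move=> mZ indep mf f0 us.
(* The functions are introduced one by one, the other variables being kept in
   arbitrary events. *)
suff gen (s1 s2 : seq int) (A : int -> set U) :
    uniq (s1 ++ s2) -> (forall k, measurable (A k)) ->
    \int[P]_(x in \bigcap_(k in [set` s2]) (Z k @^-1` A k))
      (\prod_(k <- s1) f k (Z k x))%:E =
    \prod_(k <- s1) \int[P]_x (f k (Z k x))%:E *
    \prod_(k <- s2) P (Z k @^-1` A k).
  have := gen s [::] (fun=> setT); rewrite cats0 => /(_ us (fun=> measurableT)).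
  by rewrite big_nil mule1 bigcap_seq big_nil.
have prod0 (r : seq int) : 0 <= \prod_(k <- r) \int[P]_x (f k (Z k x))%:E.
  by apply: prode_ge0 => k _; apply: integral_ge0 => x _; rewrite lee_fin.
elim: s1 s2 A => [|k0 s1 IH] s2 A us12 mA.
  rewrite big_nil mul1e; under eq_integral do rewrite big_nil.
  rewrite integral_cst ?mul1e; first exact: indep.
  exact: measurable_bigcap_preimage.
have us1 : uniq (s1 ++ k0 :: s2) by rewrite -cat1s uniq_catCA.
have k0s2 : k0 \notin s2.
  by move: us12; rewrite /= mem_cat negb_or => /andP[/andP[]].
under eq_integral do rewrite big_cons mulrC.
rewrite (@ge0_integral_weighted _ (fun x => \prod_(k <- s1) f k (Z k x))%R (Z k0)
  (\prod_(k <- s1) \int[P]_x (f k (Z k x))%:E *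
   \prod_(k <- s2) P (Z k @^-1` A k)) (f k0))//.
- by rewrite big_cons muleC muleA.
- exact: measurable_bigcap_preimage.
- by apply: measurable_prod => k _; exact: measurableT_comp.
- by move=> x; exact: prodr_ge0.
- by rewrite mule_ge0// prode_ge0.
move=> A0 mA0; pose A' k := if k == k0 then A0 else A k.
have A's2 k : k \in s2 -> A' k = A k.
  by rewrite /A'; case: eqVneq => // ->; rewrite (negPf k0s2).
have A'k0 : A' k0 = A0 by rewrite /A' eqxx.
have -> : \bigcap_(k in [set` s2]) (Z k @^-1` A k) `&` Z k0 @^-1` A0 =
    \bigcap_(k in [set` k0 :: s2]) (Z k @^-1` A' k).
  rewrite !bigcap_seq big_cons A'k0 setIC; congr (_ `&` _).
  by apply: eq_big_seq => k ks2; rewrite A's2.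
rewrite IH//; last by move=> k; rewrite /A'; case: eqVneq.
rewrite big_cons A'k0 muleCA muleC; congr (_ * _ * _).
by apply: eq_big_seq => k ks2; rewrite A's2.
Qed.

End Weighted.

(** * The expected annealed passage time *)

Section MeasurableVariables.
Context {R : realType}.

Lemma measurable_invr : measurable_fun setT (@GRing.inv R).
Proof.
have -> : [set: R] = [set r | r != 0%R] `|` [set 0%R].
  by apply/seteqP; split => // r _ /=; have [->|] := eqVneq r 0%R; [right|left].
apply/measurable_funU => //; first by apply: open_measurable; exact: open_neq.
split; last exact: measurable_fun_set1.
apply: open_continuous_measurable_fun; first exact: open_neq.
by move=> r; rewrite inE => r0; exact: inv_continuous.
Qed.

Lemma measurable_xi : measurable_fun setT (@xi R).
Proof. exact: (measurableT_comp (f := fun m : nat => m%:R : R)). Qed.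

Lemma measurable_rho : measurable_fun setT (@rho R).
Proof.
apply: measurable_funM.
  by apply: measurable_funB => //; exact: measurable_snd.
exact: (measurableT_comp measurable_invr measurable_snd).
Qed.

(** The pairs [(xi, lambda)] with [xi >= 1] and [lambda] in [(0, 1)]. *)
Definition admissible : set (nat * R) :=
  [set u | (0 < u.1)%N /\ (0 < lambda u < 1)%R].

Lemma measurable_admissible : measurable admissible.
Proof.
rewrite (_ : admissible = [set m | (0 < m)%N] `*` `]0%R, 1%R[%classic).
  exact: measurableX.
by apply/seteqP; split => -[m r] [] /=; rewrite in_itv.
Qed.

Lemma xi_ge1 u : admissible u -> (1 <= xi u :> R)%R.
Proof. by move=> [u0 _]; rewrite ler1n. Qed.

Lemma admissible_rho_gt0 u : admissible u -> (0 < rho u)%R.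
Proof. by move=> [_ /andP[u0 u1]]; rewrite divr_gt0// subr_gt0. Qed.

End MeasurableVariables.

Section PassageExpectation.
Context {R : realType} {d0 : measure_display} {T0 : measurableType d0}
  {P0 : probability T0 R} (Z : {RV P0 >-> (nat * R)%type}).
Hypothesis hZ : {ae P0, forall t, admissible (Z t)}.
Context {dE : measure_display} {E : measurableType dE} {PE : probability E R}
  (Zs : int -> {RV PE >-> (nat * R)%type}).
Hypothesis Zs_law : forall (k : int) (A : set (nat * R)), measurable A ->
  distribution PE (Zs k) A = distribution P0 Z A.
Hypothesis Zs_indep : mutually_independent PE (fun k e => Zs k e).

Lemma admissible_copies : {ae PE, forall e, forall k, admissible (Zs k e)}.
Proof.
have mG := measurable_admissible (R := R).
have one k : {ae PE, forall e, admissible (Zs k e)}.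
  apply/negligibleP.
    by apply: measurableC; rewrite -[X in measurable X]setTI; apply: measurable_funPT.
  have /negligibleP Z0 := hZ.
  have := Zs_law k (measurableC mG); rewrite /distribution/pushforward/= => ->.
  apply: Z0; apply: measurableC; rewrite -[X in measurable X]setTI.
  exact: measurable_funPT.
have pos := ae_foralln (fun m => one (Posz m)).
have neg := ae_foralln (fun m => one (Negz m)).
by apply: filterS2 pos neg => e pos neg [m|m].
Qed.

Lemma integral_copy k (g : nat * R -> R) :
  measurable_fun setT g -> (forall u, (0 <= g u)%R) ->
  \int[PE]_e (g (Zs k e))%:E = \int[P0]_t (g (Z t))%:E.
Proof.
move=> mg g0; have mgE : measurable_fun setT (EFin \o g) by exact/measurable_EFinP.
have gE0 u : 0 <= (EFin \o g) u by rewrite lee_fin.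
rewrite -(ge0_integral_distribution (Zs k) mgE gE0).
rewrite -(ge0_integral_distribution Z mgE gE0).
by apply: eq_measure_integral => A mA _; exact: Zs_law.
Qed.

(** [factor j] distributes the factors of the [j]-th term of the passage time
    over the independent variables; absolute values make them nonnegative
    everywhere. *)
Let factor (j : nat) (k : int) (u : nat * R) : R :=
  if k == 1%R then (`|rho u| * xi u)%R else
  if k == (- j%:Z)%R then (2 * xi u)%R else `|rho u|%R.

(** The indices of the copies that occur in the [j]-th term. *)
Let indices (j : nat) : seq int :=
  1%R :: (- j%:Z)%R :: [seq (- i%:Z)%R | i <- index_iota 0 j].

Let measurable_factor j k : measurable_fun setT (factor j k).
Proof.
have mr : measurable_fun setT (fun u : nat * R => `|rho u|%R).
  by apply: measurableT_comp => //; exact: measurable_rho.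
rewrite /factor; case: (k == 1%R); first exact: (measurable_funM mr measurable_xi).
case: (k == _) => //; apply: measurable_funM => //; exact: measurable_xi.
Qed.

Let factor_ge0 j k u : (0 <= factor j k u)%R.
Proof. by rewrite /factor; case: ifP => _; [|case: ifP => _]; rewrite ?mulr_ge0. Qed.

Let uniq_indices j : uniq (indices j).
Proof.
rewrite /indices /= inE map_inj_uniq ?iota_uniq ?andbT; last by move=> a b; lia.
apply/andP; split; first rewrite negb_or; first (apply/andP; split); first by lia.
- by apply/mapP => -[i _]; lia.
- by apply/mapP => -[i]; rewrite mem_index_iota; lia.
Qed.

Let factor_first j u : factor j 1%R u = (`|rho u| * xi u)%R.
Proof. by rewrite /factor eqxx. Qed.

Let factor_last j u : factor j (- j%:Z)%R u = (2 * xi u)%R.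
Proof. by rewrite /factor eqxx ifF//; lia. Qed.

Let factor_middle j i u : (i < j)%N -> factor j (- i%:Z)%R u = `|rho u|%R.
Proof. by move=> ij; rewrite /factor !ifF//; lia. Qed.

Let factor_term e j : (forall k, admissible (Zs k e)) ->
  (xi (Zs 1%R e) * block_term (fun k => Zs k e) 0%R j =
   \prod_(k <- indices j) factor j k (Zs k e))%R.
Proof.
move=> He; have rho0 k : (`|rho (Zs k e)| = rho (Zs k e) :> R)%R.
  by rewrite gtr0_norm// admissible_rho_gt0.
rewrite /indices !big_cons big_map factor_first factor_last rho0.
rewrite [in RHS](@eq_big_nat _ _ _ 0 j _ (fun i => rho (Zs (- i%:Z)%R e))); last first.
  by move=> i ij; rewrite factor_middle ?rho0//; lia.
rewrite /block_term big_nat_recl// add0r subr0 add0r.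
rewrite [in LHS](@eq_big_nat _ _ _ 0 j _ (fun i => rho (Zs (- i%:Z)%R e))).
  by ring.
by move=> i _; congr (rho (Zs _ e)); lia.
Qed.

Lemma expectation_rho : 'E_P0[fun t => rho (Z t)] = \int[P0]_t (`|rho (Z t)|%R)%:E.
Proof.
have mr : measurable_fun setT (fun t => rho (Z t)).
  by apply: measurableT_comp => //; exact: measurable_rho.
rewrite unlock; apply: ae_eq_integral => //.
- exact/measurable_EFinP.
- by apply/measurable_EFinP; exact: measurableT_comp.
- by apply: filterS hZ => t Zt _; rewrite gtr0_norm// admissible_rho_gt0.
Qed.

Lemma expectation_rhoxi : 'E_P0[fun t => (rho (Z t) * xi (Z t))%R] =
  \int[P0]_t (`|rho (Z t)| * xi (Z t))%:E.
Proof.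
have mr : measurable_fun setT (fun t => rho (Z t)).
  by apply: measurableT_comp => //; exact: measurable_rho.
have mx : measurable_fun setT (fun t => xi (Z t)).
  by apply: measurableT_comp => //; exact: measurable_xi.
rewrite unlock; apply: ae_eq_integral => //.
- by apply/measurable_EFinP; exact: measurable_funM.
- by apply/measurable_EFinP; apply: measurable_funM => //; exact: measurableT_comp.
- by apply: filterS hZ => t Zt _; rewrite gtr0_norm// admissible_rho_gt0.
Qed.

Local Notation Exi := 'E_P0[fun t => xi (Z t)].
Local Notation Exi2 := 'E_P0[fun t => (xi (Z t) ^+ 2)%R].
Local Notation Erho := 'E_P0[fun t => rho (Z t)].
Local Notation Erhoxi := 'E_P0[fun t => (rho (Z t) * xi (Z t))%R].

Let integral_term j :
  \int[PE]_e (\prod_(k <- indices j) factor j k (Zs k e))%:E =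
  2%:E * Erhoxi * Exi * Erho ^+ j.
Proof.
rewrite (@integral_prod_independent _ _ _ _ _ PE (fun k e => Zs k e) (factor j))//.
rewrite /indices !big_cons big_map.
have -> : \int[PE]_e (factor j 1%R (Zs 1%R e))%:E = Erhoxi.
  by rewrite integral_copy// expectation_rhoxi; under eq_integral do rewrite factor_first.
have -> : \int[PE]_e (factor j (- j%:Z)%R (Zs (- j%:Z)%R e))%:E = 2%:E * Exi.
  rewrite integral_copy// unlock -ge0_integralZl//; last 2 first.
  - apply/measurable_EFinP; apply: measurableT_comp => //; exact: measurable_xi.
  - by move=> t _; rewrite lee_fin.
  by apply: eq_integral => t _; rewrite factor_last.
rewrite (@eq_big_nat _ _ _ 0 j _ (fun=> Erho)); last first.
  move=> i ij; rewrite integral_copy// expectation_rho.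
  by apply: eq_integral => t _; rewrite factor_middle//; lia.
rewrite [X in _ * (_ * X)](_ : _ = Erho ^+ j).
  by rewrite muleA [Erhoxi * _]muleA [Erhoxi * _]muleC.
elim: j => [|j IH]; first by rewrite big_geq.
by rewrite big_nat_recl// IH expeS.
Qed.

Context {dW : measure_display} {W : measurableType dW} (X : nat -> W -> int).
Hypothesis mX : forall (n : nat) (i : int), measurable [set x | X n x = i].
Context (Pq : R.-pker E ~> W).
Hypothesis hPq : {ae PE, forall e,
  is_walk_in_env (sparse_env (fun k => Zs k e)) X (Pq e)}.

Lemma expected_passage_time :
  \int[annealed PE Pq]_ex
     passage_time X (marked_sites (fun k => Zs k ex.1) 1%R) ex.2 =
  Exi2 + \sum_(0 <= j <oo) (2%:E * Erhoxi * Exi * Erho ^+ j).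
Proof.
under eq_integral do rewrite marked_sites1.
have mN i : measurable [set e | (Zs 1%R e).1 = i].
  have m1 : measurable_fun setT (fun e => (Zs 1%R e).1).
    by apply: (measurableT_comp measurable_fst).
  by rewrite -[X in measurable X]setTI; exact: (m1 measurableT [set i]).
rewrite (annealed_passage_time PE Pq mX (N := fun e => (Zs 1%R e).1))//.
have mx : measurable_fun setT (fun e => xi (Zs 1%R e)).
  by apply: measurableT_comp => //; exact: measurable_xi.
have mprod j : measurable_fun setT (fun e => \prod_(k <- indices j) factor j k (Zs k e))%R.
  by apply: measurable_prod => k _; exact: measurableT_comp.
have prod0 j e : 0 <= (\prod_(k <- indices j) factor j k (Zs k e))%:E.
  by rewrite lee_fin prodr_ge0.
transitivity (\int[PE]_e ((xi (Zs 1%R e) ^+ 2)%:E +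
    \sum_(0 <= j <oo) (\prod_(k <- indices j) factor j k (Zs k e))%:E)).
  apply: ge0_ae_eq_integral => //.
  - apply: (ge0_emeasurable_sum (P := xpredT)) => // k _.
    exact: measurable_avoid.
  - apply: emeasurable_funD.
      by apply/measurable_EFinP; exact: measurable_funX.
    apply: (ge0_emeasurable_sum (P := xpredT)) => // k _.
    exact/measurable_EFinP.
  - by move=> e _; apply: nneseries_ge0.
  - move=> e _; apply: adde_ge0; first by rewrite lee_fin sqr_ge0.
    exact: nneseries_ge0.
  have := admissible_copies; apply: filterS2 hPq => e walk_e He _.
  pose z k := Zs k e.
  have z0 k : (0 < (z k).1)%N by case: (He k).
  have z01 k : (0 < lambda (z k) < 1)%R by case: (He k).
  transitivity (mean_passage (sparse_env z) (marked_sites z 1%R) 0%R).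
    rewrite marked_sites1; apply: eq_eseriesr => k _.
    by rewrite (measure_avoid mX _ walk_e)// prob_kernel.
  rewrite mean_passage_sparse//; congr (_ + _).
  by apply: eq_eseriesr => j _; rewrite factor_term.
rewrite ge0_integralD//; last 4 first.
- by move=> e _; rewrite lee_fin sqr_ge0.
- by apply/measurable_EFinP; exact: measurable_funX.
- by move=> e _; exact: nneseries_ge0.
- apply: (ge0_emeasurable_sum (P := xpredT)) => // k _; exact/measurable_EFinP.
congr (_ + _).
  rewrite (@integral_copy 1%R (fun u => xi u ^+ 2)%R) ?unlock//; last first.
    by move=> u; rewrite sqr_ge0.
  by apply: measurable_funX; exact: measurable_xi.
rewrite integral_nneseries//; last by move=> j; exact/measurable_EFinP.
by apply: eq_eseriesr => j _; exact: integral_term.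
Qed.

End PassageExpectation.

(** * The speed as a function of the moments *)

Lemma nneseries_geometric (R : realType) (c r : R) : (0 <= r < 1)%R ->
  \sum_(0 <= j <oo) (c * r ^+ j)%:E = (c / (1 - r))%:E.
Proof.
move=> /andP[r0 r1]; apply/cvg_lim => //.
under eq_fun do rewrite sumEFin; apply: cvg_EFin; first by near=> n.
by apply: (@cvg_geometric_series R c r); rewrite ger0_norm.
Unshelve. all: by end_near. Qed.

(** Here [x], [x2], [r] and [rx] stand for the expectations of [xi], [xi ^ 2], [rho]
    and [rho * xi]. *)
Lemma speed_of_moments (R : realType) (x : R) (x2 r rx : \bar R) :
  (1 <= x)%R -> 1 <= x2 -> 0 <= r -> r <= rx ->
  let T := x2 + \sum_(0 <= j <oo) (2%:E * rx * x%:E * r ^+ j) in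
  let v := x%:E / T in
  ((r < 1 /\ rx < +oo /\ x2 < +oo) ->
     v = ((1 - r) * x%:E) / ((1 - r) * x2 + 2%:E * x%:E * rx) /\
     v^-1 = x%:E^-1 * (x2 + (2%:E * x%:E * rx) / (1 - r))) /\
  (~ (r < 1 /\ rx < +oo /\ x2 < +oo) -> v = 0 /\ v^-1 = +oo).
Proof.
move=> x1 x21 r0 r_rx T v.
have x0 : (0 < x)%R by apply: lt_le_trans x1.
have rx0 : 0 <= rx by apply: le_trans r_rx.
have t0 j : 0 <= 2%:E * rx * x%:E * r ^+ j.
  by rewrite !mule_ge0 ?expe_ge0// lee_fin ltW.
split=> [[r1 [rxfin x2fin]]|inf].
  have /fineK re : r \is a fin_num by rewrite ge0_fin_numE// (lt_trans r1) ?ltry.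
  have /fineK rxe : rx \is a fin_num by rewrite ge0_fin_numE.
  have /fineK x2e : x2 \is a fin_num by rewrite ge0_fin_numE// (le_trans _ x21).
  move: re rxe x2e => re rxe x2e.
  rewrite /v /T -re -rxe -x2e in r1 x21 r0 rx0 *.
  move: (fine r) (fine rx) (fine x2) r1 x21 r0 rx0 => q s y.
  rewrite !lee_fin lte_fin => q1 y1 q0 s0.
  have -> : \sum_(0 <= j <oo) (2%:E * s%:E * x%:E * q%:E ^+ j) =
      (2 * s * x / (1 - q))%:E.
    rewrite -nneseries_geometric ?q0//.
    by apply: eq_eseriesr => j _; rewrite -EFin_expe -!EFinM.
  have q'0 : (0 < 1 - q)%R by rewrite subr_gt0.
  have p0 : (0 <= 2 * s * x / (1 - q))%R.
    by rewrite divr_ge0 ?mulr_ge0// ltW.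
  have T0 : (y + 2 * s * x / (1 - q) != 0)%R by rewrite gt_eqF// ltr_pwDl// (lt_le_trans _ y1).
  have D0 : ((1 - q) * y + 2 * x * s != 0)%R.
    rewrite gt_eqF// ltr_pwDl ?mulr_ge0 ?(ltW x0)// mulr_gt0//.
    exact: lt_le_trans y1.
  have q'n0 : (1 - q != 0)%R by rewrite gt_eqF.
  have xn0 : x != 0%R by rewrite gt_eqF.
  rewrite -!EFinB -!EFinM -!EFinD !inver (negPf T0) (negPf D0) (negPf q'n0) (negPf xn0).
  rewrite -!EFinM; split; first by congr (_%:E); field; apply/andP.
  rewrite inver mulf_eq0 invr_eq0 (negPf xn0) (negPf T0) /=.
  have D0' : (y * (1 - q) + 2 * s * x != 0)%R by rewrite mulrC mulrAC.
  by congr (_%:E); field; apply/and3P.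
suff Too : T = +oo by rewrite /v Too invey mule0 inve0.
have series_ge0 : 0 <= \sum_(0 <= j <oo) (2%:E * rx * x%:E * r ^+ j).
  exact: nneseries_ge0.
have notNy (y : \bar R) : 0 <= y -> y != -oo by case: y.
have [x2oo|x2fin] := eqVneq x2 +oo; first by rewrite /T x2oo addye// notNy.
rewrite /T (_ : \sum_(_ <= _ <oo) _ = +oo).
  by rewrite addey// notNy// (le_trans _ x21).
have [rxoo|rxfin] := eqVneq rx +oo.
  apply: (nneseries_pinfty (k := 0%N)) => //.
  by rewrite rxoo expe0 mule1 gt0_muley ?lte_fin// gt0_mulye ?lte_fin.
have r1 : 1 <= r.
  by rewrite leNgt; apply/negP => r1; apply: inf; rewrite r1 !ltey.
have rj1 j : 1 <= r ^+ j.
  elim: j => [|j IH]; first by rewrite expe0.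
  by rewrite expeS -[leLHS]mule1 lee_pmul.
apply: (@nneseries_ge_cst _ _ 1) => // j.
rewrite -[leLHS]mule1 lee_pmul// -[leLHS]mule1 lee_pmul ?lee_fin//.
by rewrite -[leLHS]mule1 lee_pmul ?lee_fin ?ler1n// (le_trans r1).
Qed.

Theorem proposition2p1 (R : realType)
  (* the random vector (xi, lambda) *)
  (d0 : measure_display) (T0 : measurableType d0) (P0 : probability T0 R)
  (Z : {RV P0 >-> (nat * R)%type})
  (hZ : {ae P0, forall t, (0 < (Z t).1)%N /\ (0 < lambda (Z t) < 1)%R})
  (* its independent copies, indexed by the integers *)
  (dE : measure_display) (E : measurableType dE) (PE : probability E R)
  (Zs : int -> {RV PE >-> (nat * R)%type})
  (Zs_law : forall (k : int) (A : set (nat * R)), measurable A ->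
     distribution PE (Zs k) A = distribution P0 Z A)
  (Zs_indep : mutually_independent PE (fun k e => Zs k e))
  (* the walk and its quenched laws *)
  (dW : measure_display) (W : measurableType dW) (X : nat -> W -> int)
  (mX : forall (n : nat) (i : int), measurable [set x | X n x = i])
  (Pq : R.-pker E ~> W)
  (hPq : {ae PE, forall e,
     is_walk_in_env (sparse_env (fun k => Zs k e)) X (Pq e)})
  (* E log rho exists in [-oo, 0) and E xi is finite *)
  (hlog_pos : 'E_P0[fun t => Num.max (ln (rho (Z t))) 0%R] < +oo)
  (hlog : 'E_P0[fun t => ln (rho (Z t))] < 0)
  (hxi : 'E_P0[fun t => xi (Z t)] < +oo) :
  let Exi := 'E_P0[fun t => xi (Z t)] in
  let Exi2 := 'E_P0[fun t => (xi (Z t) ^+ 2)%R] in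
  let Erho := 'E_P0[fun t => rho (Z t)] in
  let Erhoxi := 'E_P0[fun t => (rho (Z t) * xi (Z t))%R] in
  let ET := \int[annealed PE Pq]_ex
              passage_time X (marked_sites (fun k => Zs k ex.1) 1) ex.2 in
  (* in \bar R, x / +oo = 0 and 0^-1 = +oo *)
  let v := Exi / ET in
  ((Erho < 1 /\ Erhoxi < +oo /\ Exi2 < +oo) ->
     v = ((1 - Erho) * Exi) / ((1 - Erho) * Exi2 + 2%:E * Exi * Erhoxi) /\
     v^-1 = Exi^-1 * (Exi2 + (2%:E * Exi * Erhoxi) / (1 - Erho))) /\
  (~ (Erho < 1 /\ Erhoxi < +oo /\ Exi2 < +oo) -> v = 0 /\ v^-1 = +oo).
Proof.
move=> Exi Exi2 Erho Erhoxi ET v.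
have mx : measurable_fun setT (fun t => xi (Z t)).
  by apply: measurableT_comp => //; exact: measurable_xi.
have mr : measurable_fun setT (fun t => rho (Z t)).
  by apply: measurableT_comp => //; exact: measurable_rho.
have int1 : \int[P0]_t (1%R)%:E = 1 :> \bar R.
  by rewrite integral_cst// mul1e; exact: probability_setT.
have Exi_ge1 : 1 <= Exi.
  rewrite /Exi unlock -int1; apply: ae_ge0_le_integral => //.
  - by move=> t _; rewrite lee_fin.
  - exact/measurable_EFinP.
  - by apply: filterS hZ => t /xi_ge1 xi1 _; rewrite lee_fin.
have Exi2_ge1 : 1 <= Exi2.
  rewrite /Exi2 unlock -int1; apply: ae_ge0_le_integral => //.
  - by move=> t _; rewrite lee_fin sqr_ge0.
  - by apply/measurable_EFinP; exact: measurable_funX.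
  - by apply: filterS hZ => t /xi_ge1 xi1 _; rewrite lee_fin exprn_ege1.
have Erho_ge0 : 0 <= Erho.
  by rewrite /Erho (expectation_rho hZ) integral_ge0.
have Erho_le : Erho <= Erhoxi.
  rewrite /Erho /Erhoxi (expectation_rho hZ) (expectation_rhoxi hZ).
  have ma : measurable_fun setT (fun t => `|rho (Z t)|%R) by exact: measurableT_comp.
  apply: ae_ge0_le_integral => //.
  - exact/measurable_EFinP.
  - by move=> t _; rewrite lee_fin mulr_ge0.
  - by apply/measurable_EFinP; exact: measurable_funM.
  - by apply: filterS hZ => t /xi_ge1 xi1 _; rewrite lee_fin ler_peMr.
have /fineK ExiE : Exi \is a fin_num by rewrite ge0_fin_numE// (le_trans _ Exi_ge1).
rewrite /v /ET (expected_passage_time hZ Zs_law Zs_indep mX hPq).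
rewrite -/Exi -/Exi2 -/Erho -/Erhoxi -ExiE.
by apply: speed_of_moments => //; rewrite -lee_fin ExiE.
Qed.
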